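(* Every integer $n > 4$ may be written as $n = p_1 + p_2 + \eta$, where $p_1, p_2$ are primes (not necessarily distinct) and $\eta$ is a square-free number.
   Context: A square-free number is a positive integer not divisible by the square of any prime; in particular $1$ is square-free. *)

(* Defs.v *)
From mathcomp Require Import all_boot.
Set Implicit Arguments.
Unset Strict Implicit.
Unset Printing Implicit Defensive.

Definition squarefree (m : nat) : Prop :=
  0 < m /\ forall p : nat, prime p -> ~~ (p ^ 2 %| m).

(* Main.v *)
(* Taking p1 = 2 or p1 = 3 according to the parity of n, it suffices to write
   every even m >= 4 as a prime plus a square-free number.  If this fails for m,
   then for every odd prime p < m there is an odd prime q with q^2 | m - p, so p
   lies in a single residue class mod k = 2 q^2.

   A Chebyshev argument bounds the primes of such a class: the part of N! prime
   to k divides the product of the first N terms of the class, so those primes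
   > N among them multiply to at most k^N 2^N q^(N/(q-1)).  In base-2 logarithms,
   the primes below m of the class of q contribute at most about
   e_q m / (2 (q^2 - 1)), where e_3 = 6, e_5 = 8 and e_q = 2 floor(log2 q) + 5 for
   the other q.  These sum to at most 19/20 m, while the central binomial
   coefficient shows that all the primes below m contribute at least
   m - O(sqrt m log m).  This is a contradiction for m >= 2^22.

   For smaller m a pigeonhole count suffices: there are more odd primes below some
   small y than can be absorbed by the classes of all the primes q <= sqrt m. *)
Require Import Defs.
From mathcomp Require Import all_boot all_order all_algebra.
From mathcomp Require Import zify ring lra.
Import Order.TTheory GRing.Theory Num.Theory.

(** * Primes in an arithmetic progression *)

(** The quotient is the binomial coefficient ['C(c + N, N)]. *)
Lemma dvdn_fact_rising N c : N`! %| \prod_(j < N) (c.+1 + j).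
Proof.
suff E : \prod_(j < N) (c.+1 + j) * c`! = (c + N)`!.
  have := bin_fact (leq_addl c N); rewrite addnK -E mulnA => /eqP.
  by rewrite eqn_pmul2r ?fact_gt0 // => /eqP <-; rewrite dvdn_mull.
elim: N => [|N IH]; first by rewrite big_ord0 mul1n addn0.
by rewrite big_ord_recr /= mulnAC IH addnS factS addSn mulnC.
Qed.

(** As [k] is invertible modulo [M], the Chinese remainder theorem allows [a] to be replaced by a
    multiple of [k]; the product becomes [k ^ N] times [N] consecutive integers. *)
Lemma dvdn_prod_progression M a k N :
  coprime M k -> 0 < k -> 0 < M -> M %| N`! -> M %| \prod_(j < N) (a + j * k).
Proof.
move=> coMk k0 M0 MN.
(* The summand [M * k] makes [x] positive. *)
pose x := M * k + chinese M k a 0.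
have xa : x = a %[mod M] by rewrite /x mulnC modnMDl chinese_modl.
have : k %| x by rewrite dvdn_addr ?dvdn_mull // /dvdn chinese_modr // mod0n.
case/dvdnP=> b xE.
have b0 : 0 < b by move: xE; rewrite /x; case: b => //; nia.
case: b b0 xE => // c _ xE.
have -> : (M %| \prod_(j < N) (a + j * k)) = (M %| \prod_(j < N) (x + j * k)).
  rewrite /dvdn; congr (_ == _).
  apply: (big_ind2 (fun u v => u = v %[mod M])) => // [u u' v v' Eu Ev|i _].
    by rewrite -modnMm Eu Ev modnMm.
  by rewrite -modnDml -xa modnDml.
apply: dvdn_trans (MN) _; apply: dvdn_trans (dvdn_fact_rising N c) _.
under [X in _ %| X]eq_bigr do rewrite xE -mulnDl.
by rewrite big_split dvdn_mulr.
Qed.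

(** The part [M] of [N!] prime to [k] divides the whole product and is coprime to each prime above
    [N], so it divides the product [R] of the other terms. Since [a + j * k <= k * j.+1], the whole
    product is at most [k ^ N * N!]; then divide by [M <= R]. *)
Lemma prod_large_primes_le a k N : 0 < a -> a <= k ->
  \prod_(j < N | prime (a + j * k) && (N < a + j * k)) (a + j * k)
    <= k ^ N * (N`!)`_(\pi(k)).
Proof.
move=> a0 ak; have k0 : 0 < k by lia.
pose M := (N`!)`_(\pi(k)^').
have M0 : 0 < M by rewrite part_gt0.
have coMk : coprime M k.
  by rewrite coprime_sym -[X in coprime X](partn_pi k0) coprime_partC.
have Mdvd : M %| \prod_(j < N) (a + j * k).
  by apply: dvdn_prod_progression => //; exact: dvdn_part.
set S := \prod_(j < N | _) _.
rewrite (bigID (fun j : 'I_N => prime (a + j * k) && (N < a + j * k))) /= -/S in Mdvd.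
set R := \prod_(j < N | ~~ _) _ in Mdvd.
have coMS : coprime M S.
  rewrite /S; apply: (big_ind (coprime M)) => [|u v|j /andP[pp Np]].
  - exact: coprimen1.
  - by rewrite coprimeMr => -> ->.
  rewrite coprime_sym prime_coprime //; apply: contraL Np => pM.
  have : a + j * k %| N`! by apply: dvdn_trans pM (dvdn_part _ _).
  rewrite fact_prod Euclid_dvd_prod // big_has -leqNgt => /hasP[i].
  by rewrite mem_index_iota => /andP[i0 iN] /dvdn_leq; lia.
have R0 : 0 < R by apply: prodn_gt0 => j; lia.
have MR : M <= R by apply: dvdn_leq => //; rewrite -(Gauss_dvdr _ coMS).
have SR : S * R <= k ^ N * N`!.
  have -> : S * R = \prod_(j < N) (a + j * k).
    by rewrite [RHS](bigID (fun j : 'I_N => prime (a + j * k) && (N < a + j * k))).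
  have -> : k ^ N = \prod_(j < N) k by rewrite prod_nat_const card_ord.
  rewrite fact_prod big_add1 /= big_mkord -big_split /=.
  by apply: leq_prod => j _; nia.
rewrite -(leq_pmul2r M0); apply: leq_trans (leq_mul (leqnn S) MR) _.
by rewrite -mulnA partnC ?fact_gt0.
Qed.

Lemma leq_prod_ord_subset n m (P Q : pred nat) (F : nat -> nat) :
  (forall j, j < n -> P j -> (j < m) && Q j) -> (forall j, Q j -> 0 < F j) ->
  \prod_(j < n | P j) F j <= \prod_(j < m | Q j) F j.
Proof.
move=> PQ F0.
rewrite (big_ord_widen_cond (maxn n m)) ?leq_maxl //.
rewrite (big_ord_widen_cond (maxn n m) Q) ?leq_maxr //.
rewrite big_mkcond [leqRHS]big_mkcond; apply: leq_prod => j _.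
case: ifP => [/andP[Pj jn]|_]; last by case: ifP => // /andP[/F0].
by rewrite andbC PQ.
Qed.

Lemma logn_fact_leq p N : prime p -> logn p N`! * p.-1 <= N.
Proof.
move=> pp; rewrite logn_fact // big_add1 /= big_mkord.
have p1 := prime_gt1 pp.
have [d pE] : exists d, p = d.+1 by exists p.-1; lia.
(* The remainder [N %/ p ^ K] makes the bound on Legendre's sum telescope. *)
suff H K : (\sum_(i < K) N %/ p ^ i.+1) * d + N %/ p ^ K <= N.
  have -> : p.-1 = d by rewrite pE.
  exact: leq_trans (leq_addr _ _) (H N).
elim: K => [|K IH]; first by rewrite big_ord0 divn1.
rewrite big_ord_recr /= expnSr divnMA mulnDl.
have : N %/ p ^ K %/ p + N %/ p ^ K %/ p * d <= N %/ p ^ K.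
  by rewrite -mulnS -pE leq_divM.
by move: IH; set s := \sum_(_ < _) _; move: s (N %/ p ^ K) => s u; move: (u %/ p) => v; lia.
Qed.

Lemma partn_two_primes p q n : prime p -> prime q -> p != q -> 0 < n ->
  n`_(\pi(p * q ^ 2)) = p ^ logn p n * q ^ logn q n.
Proof.
move=> pp pq npq n0.
have pi2 r : (r \in \pi(p * q ^ 2)) = (r == p) || (r == q).
  rewrite mem_primes muln_gt0 expn_gt0 !prime_gt0 //=.
  apply/andP/orP => [[rp]|].
    by rewrite Euclid_dvdM // Euclid_dvdX // andbT !dvdn_prime2 // => /orP.
  case=> /eqP->; split=> //. by rewrite dvdn_mulr. by rewrite dvdn_mull // dvdn_exp.
rewrite (@widen_partn (p + q + n)) ?leq_addl //.
rewrite -big_filter (bigD1_seq p); last 2 first.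
- by rewrite mem_filter pi2 eqxx mem_index_iota; lia.
- by rewrite filter_uniq // iota_uniq.
congr (_ * _); rewrite -big_filter (bigD1_seq q); last 2 first.
- by rewrite !mem_filter pi2 eqxx orbT mem_index_iota eq_sym npq /=; lia.
- by rewrite !filter_uniq // iota_uniq.
rewrite big_seq_cond big1 => [|r]; first exact: muln1.
by rewrite !mem_filter pi2; case: (r =P p); case: (r =P q) => // _ _ /andP[].
Qed.

(** In [N!] the exponent of 2 is at most [N] and that of [q] at most [N / (q - 1)]. Everything is
    raised to the power [q.-1] to clear this fraction. *)
Lemma prod_large_primes_le2 q e a N : prime q -> 2 < q -> 0 < a -> a <= 2 * q ^ 2 ->
  (4 * q ^ 2) ^ q.-1 * q <= 2 ^ (e * q.-1) ->
  \prod_(j < N | prime (a + j * (2 * q ^ 2)) && (N < a + j * (2 * q ^ 2)))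
     (a + j * (2 * q ^ 2)) <= 2 ^ (e * N).
Proof.
move=> pq q2 a0 ak Hq; set k := 2 * q ^ 2.
apply: leq_trans (prod_large_primes_le a k N a0 ak) _; rewrite -/k.
rewrite partn_two_primes ?fact_gt0 //; last by rewrite ltn_eqF.
have v2 : logn 2 N`! <= N by have := logn_fact_leq 2 N isT; rewrite muln1.
have vq := logn_fact_leq q N pq.
have q10 : 0 < q.-1 by lia.
rewrite -(leq_exp2r _ _ q10).
have -> : (2 ^ (e * N)) ^ q.-1 = (2 ^ (e * q.-1)) ^ N by rewrite -!expnM mulnAC.
apply: leq_trans (_ : ((4 * q ^ 2) ^ q.-1 * q) ^ N <= _); last first.
  by case: (posnP N) => [->|N0]; rewrite ?expn0 ?leq_exp2r.
have -> : 4 * q ^ 2 = k * 2 by rewrite /k mulnAC.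
move: k {ak Hq} => k.
rewrite !expnMn -!expnM (mulnC N) -!mulnA leq_mul2l; apply/orP; right.
by rewrite leq_mul ?leq_exp2l ?prime_gt1 // mulnC leq_mul2l v2 orbT.
Qed.

(* Splitting at N, the small primes of the progression lie among its first
   N / k terms, so the bound can be iterated. *)
Lemma prod_progression_primes_le q e a N : prime q -> 2 < q -> 0 < a -> a <= 2 * q ^ 2 ->
  2 * q ^ 2 <= 2 ^ e -> (4 * q ^ 2) ^ q.-1 * q <= 2 ^ (e * q.-1) ->
  exists2 s, \prod_(j < N | prime (a + j * (2 * q ^ 2))) (a + j * (2 * q ^ 2)) <= 2 ^ (e * s)
    & (2 * q ^ 2 - 2) * s <= 2 * q ^ 2 * N + (2 * q ^ 2 - 2).
Proof.
move=> pq q2 a0 ak ke Hq.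
have Hlarge M := prod_large_primes_le2 q e a M pq q2 a0 ak Hq.
have k17 : 17 < 2 * q ^ 2 by rewrite -(@leq_sqr 3) in q2; lia.
move: (2 * q ^ 2) ak ke k17 Hlarge => k ak ke k17 Hlarge {Hq}.
elim/ltn_ind: N => N IH.
have [->|N0] := posnP N.
  by exists 0; rewrite ?big_ord0 ?muln0.
have small : \prod_(j < N | prime (a + j * k) && (a + j * k <= N)) (a + j * k)
    <= \prod_(j < (N.-1 %/ k).+1 | prime (a + j * k)) (a + j * k).
  apply: (leq_prod_ord_subset N _ (fun j => prime (a + j * k) && (a + j * k <= N))
    (fun j => prime (a + j * k)) (fun j => a + j * k)) => [j _ /andP[-> jN]|j /prime_gt0 //].
  by rewrite andbT ltnS leq_divRL; lia.
have split : \prod_(j < N | prime (a + j * k)) (a + j * k) <=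
    2 ^ (e * N) * \prod_(j < (N.-1 %/ k).+1 | prime (a + j * k)) (a + j * k).
  rewrite (bigID (fun j : 'I_N => N < a + j * k)) /=.
  apply: leq_mul; first exact: Hlarge.
  by under eq_bigl do rewrite -leqNgt.
have [Nk|kN] := leqP N k.
  exists N.+1; last by lia.
  apply: leq_trans split _; rewrite mulnS [e + _]addnC expnD leq_mul2l; apply/orP; right.
  rewrite divn_small ?big_mkcond ?big_ord_recl ?big_ord0 /=; last by lia.
  by case: ifP => _; rewrite ?expn_gt0 // muln1 mul0n addn0; lia.
(* As [N > k], rounding up at most doubles [N / k]. This loss is what turns [k] into [k - 2] in the
   bound on [s], the sum of the successive lengths. *)
have kN1 : k * (N.-1 %/ k).+1 <= 2 * N by have := leq_divM N.-1 k; lia.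
have [|s Hs sle] := IH (N.-1 %/ k).+1.
  by move: kN1; move: (N.-1 %/ k).+1 => N1; nia.
exists (N + s).
  by apply: leq_trans split _; rewrite mulnDr expnD leq_mul.
move: sle kN1; move: (N.-1 %/ k).+1 => N1; nia.
Qed.

(** * The central binomial coefficient *)

(** A common cut-off [T] lets the Legendre sums of [n!] and [(2 n)!] be compared term by term. *)
Lemma logn_fact_trunc p n T : prime p -> n < p ^ T.+1 ->
  logn p n`! = \sum_(i < T) n %/ p ^ i.+1.
Proof.
move=> pp nT; rewrite logn_fact // big_add1 /= big_mkord.
have widen a b : a <= b -> n < p ^ a.+1 ->
    \sum_(i < a) n %/ p ^ i.+1 = \sum_(i < b) n %/ p ^ i.+1.
  move=> ab na; rewrite (big_ord_widen b (fun i => n %/ p ^ i.+1) ab) big_mkcond /=.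
  apply: eq_bigr => i _; case: ltnP => // ai; rewrite divn_small //.
  by apply: leq_trans na _; rewrite leq_exp2l ?prime_gt1.
have nn : n < p ^ n.+1.
  by apply: leq_trans (ltn_expl n (prime_gt1 pp)) _; rewrite leq_exp2l ?prime_gt1.
by rewrite (widen n (maxn n T)) ?leq_maxl // -(widen T) ?leq_maxr.
Qed.

(** Each of the [trunc_log p n.*2] Legendre terms contributes at most 1, because
    [floor (2 x) <= 2 floor x + 1]. *)
Lemma pfactor_central_bin_leq p n : prime p -> 0 < n -> p ^ logn p 'C(n.*2, n) <= n.*2.
Proof.
move=> pp n0.
have nn : n <= n.*2 by lia.
have m0 : 0 < n.*2 by lia.
apply: leq_trans (trunc_logP (prime_gt1 pp) m0).
rewrite leq_exp2l ?prime_gt1 //.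
have mT := trunc_log_ltn n.*2 (prime_gt1 pp).
move: (trunc_log p n.*2) mT => T mT.
have := congr1 (logn p) (bin_fact nn).
have -> : n.*2 - n = n by lia.
rewrite !lognM ?muln_gt0 ?fact_gt0 ?bin_gt0 //.
rewrite !(logn_fact_trunc p _ T) //; last exact: leq_ltn_trans mT.
suff : \sum_(i < T) n.*2 %/ p ^ i.+1
    <= \sum_(i < T) (n %/ p ^ i.+1 + n %/ p ^ i.+1 + 1).
  by rewrite !big_split /= sum1_card card_ord; lia.
apply: leq_sum => i _; have p0 : 0 < p ^ i.+1 by rewrite expn_gt0 prime_gt0.
rewrite -ltnS ltn_divLR //.
have := ltn_ceil n p0; lia.
Qed.

(** Prime powers with [p <= S] are at most [2 n] each; a prime above [S] has [p ^ 2 > 2 n], so its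
    exponent is at most 1. *)
Lemma central_bin_leq n S : 0 < n -> n.*2 < S.+1 ^ 2 ->
  'C(n.*2, n) <= n.*2 ^ S * \prod_(p < n.*2.+1 | prime p) p.
Proof.
move=> n0 nS; set m := n.*2; set X := 'C(m, n).
have X0 : 0 < X by rewrite bin_gt0; lia.
have m0 : 0 < m by lia.
rewrite -[X in X <= _]partnT // (@widen_partn X) // big_mkord.
pose P p := (0 < p) && (p <= S).
apply: (@leq_trans (\prod_(p < X.+1 | P p) m * \prod_(p < X.+1 | prime p && (p <= m)) p)).
  rewrite [X in X * _]big_mkcond [X in _ * X]big_mkcond -big_split /=.
  apply: leq_prod => p _.
  have [pp|/negbTE np] := boolP (prime p); last first.
    by rewrite lognE np /= /P; case: ifP; rewrite muln1 //; lia.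
  have pm : p ^ logn p X <= m := pfactor_central_bin_leq p n pp n0.
  have [->|l0] := posnP (logn p X).
    rewrite expn0; case: ifP => _; case: ifP => _;
      by rewrite ?muln1 ?mul1n ?muln_gt0 ?m0 ?(prime_gt0 pp).
  have -> : p <= m by apply: leq_trans pm; rewrite -{1}[nat_of_ord p]expn1 leq_exp2l ?prime_gt1.
  rewrite /P prime_gt0 //=; case: (leqP p S) => pS.
    by apply: leq_trans pm _; rewrite leq_pmulr ?prime_gt0.
  rewrite mul1n -[leqRHS]expn1 leq_exp2l ?prime_gt1 // leqNgt; apply/negP => l2.
  have : p ^ 2 <= m by apply: leq_trans pm; rewrite leq_exp2l ?(prime_gt1 pp).
  have : S.+1 ^ 2 <= p ^ 2 by rewrite leq_sqr.
  lia.
apply: leq_mul.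
  apply: (@leq_trans (\prod_(p < S.+1 | 0 < p) m)).
    apply: (leq_prod_ord_subset _ _ P (fun p => 0 < p) (fun=> m)) => [p _|_ _]; last by lia.
    by rewrite /P ltnS => /andP[-> ->].
  by rewrite big_mkcond big_ord_recl /= mul1n prod_nat_const card_ord.
apply: (leq_prod_ord_subset _ _ (fun p => prime p && (p <= m)) prime id) => [p _|p /prime_gt0//].
by rewrite ltnS andbC.
Qed.

Lemma expn4_central_bin n : 4 ^ n <= n.*2.+1 * 'C(n.*2, n).
Proof.
elim: n => // n IH.
have E : n.+1 * 'C(n.+1.*2, n.+1) = 2 * (n.*2.+1 * 'C(n.*2, n)).
  have h1 := mul_bin_diag n.*2.+2 n; have h2 := mul_bin_diag n.*2.+1 n.
  have h3 : 'C(n.*2.+1, n.+1) = 'C(n.*2.+1, n).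
    by rewrite -bin_sub; [congr 'C(_, _); lia|lia].
  rewrite doubleS /= in h1 h2 *; nia.
rewrite expnS doubleS -(@leq_pmul2l n.+1) //.
rewrite doubleS in E; nia.
Qed.

(** * Covering by residue classes modulo squares *)

(** A multiplicative union bound: after exchanging the products, [F p] occurs once for each class
    containing [p]. *)
Lemma leq_prod_cover (s r : seq nat) (R : rel nat) (F : nat -> nat) :
  {in s, forall p, exists2 i, i \in r & R i p} -> {in s, forall p, 0 < F p} ->
  \prod_(p <- s) F p <= \prod_(i <- r) \prod_(p <- s | R i p) F p.
Proof.
move=> cov F0; rewrite (exchange_big_dep predT) //= big_seq [leqRHS]big_seq.
apply: leq_prod => p ps; have [i ir Rip] := cov p ps.
rewrite big_const_seq iter_muln_1 -[leqLHS]expn1 leq_pexp2l ?F0 //.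
by rewrite -has_count; apply/hasP; exists i.
Qed.

Lemma leq_prod_seq_subset (s t : seq nat) (F : nat -> nat) :
  uniq s -> {subset s <= t} -> {in t, forall p, 0 < F p} ->
  \prod_(p <- s) F p <= \prod_(p <- t) F p.
Proof.
move=> us st F0.
apply: leq_trans (leq_prod_cover s t (fun i p => p == i) F _ _) _.
- by move=> p /st; exists p.
- by move=> p /st/F0.
rewrite big_seq [leqRHS]big_seq; apply: leq_prod => i it.
rewrite (eq_bigr (fun=> F i)) => [|p /eqP-> //].
rewrite big_const_seq iter_muln_1 count_uniq_mem //.
by case: (i \in s); rewrite ?expn1 // expn0 F0.
Qed.

(** Here [p] is congruent to [m] modulo [q ^ 2], and parity fixes it modulo [2 * q ^ 2]: [a] is the
    odd one of [r] and [r + q ^ 2], where [r = m %% q ^ 2]. *)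
Lemma odd_square_class q m : odd q ->
  exists2 a, 0 < a <= 2 * q ^ 2 & forall y p, odd p -> p <= y -> p <= m ->
    q ^ 2 %| m - p -> p \in [seq a + j * (2 * q ^ 2) | j <- iota 0 (y %/ (2 * q ^ 2)).+1].
Proof.
move=> oq; set d := q ^ 2; have od : odd d by rewrite oddX oq orbT.
have d0 : 0 < d by rewrite expn_gt0 odd_gt0.
have rd : m %% d < d by rewrite ltn_mod.
exists (if odd (m %% d) then m %% d else m %% d + d).
  by case: ifP => o; lia.
move=> y p op py pm dm; apply/mapP; exists (p %/ (2 * d)).
  by rewrite mem_iota /= ltnS leq_div2r.
have pr : p %% d = m %% d by apply/eqP; rewrite eq_sym eqn_mod_dvd.
rewrite addnC {1}(divn_eq p (2 * d)); congr (_ + _).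
have := divn_eq (p %% (2 * d)) d.
rewrite (modn_dvdm p (dvdn_mull 2 (dvdnn d))) pr => E.
have lt : p %% (2 * d) < 2 * d by rewrite ltn_mod; lia.
have oE : odd (p %% (2 * d)) by move: op; rewrite {1}(divn_eq p (2 * d)) oddD mulnCA oddM.
have u2 : p %% (2 * d) %/ d < 2 by rewrite ltn_divLR.
move: oE; rewrite {}E; move: u2; move: (p %% (2 * d) %/ d) => [|[|u]].
- by move=> _ ->.
- by rewrite mul1n oddD od /= => _ /negbTE->; rewrite addnC.
- by [].
Qed.

Lemma squarefree_or_cover m (s : seq nat) : ~~ odd m ->
  {in s, forall p, odd p && (p < m)} ->
  (exists2 p, p \in s & squarefree (m - p)) \/
  {in s, forall p, exists q, [/\ prime q, odd q, q ^ 2 < m & q ^ 2 %| m - p]}.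
Proof.
move=> om ms.
(* A search below [m] suffices, since [q <= q ^ 2 <= m - p < m]; it makes the dichotomy
   decidable. *)
pose bad p := has (fun q => prime q && (q ^ 2 %| m - p)) (iota 0 m).
have [/allP sbad|/allPn[p ps /hasPn pgood]] := boolP (all bad s); [right|left].
  move=> p ps; have /andP[op pm] := ms p ps.
  have /hasP[q _ /andP[pq dq]] := sbad p ps.
  have omp : odd (m - p) by rewrite oddB ?(negbTE om) ?op // ltnW.
  have oq : odd q by have := dvdn_odd dq omp; rewrite oddX.
  exists q; split=> //; apply: leq_ltn_trans (dvdn_leq _ dq) _; first by lia.
  by have := odd_gt0 op; lia.
have /andP[op pm] := ms p ps.
exists p => //; split=> [|q pq]; first by lia.
apply/negP => dq.
have qle : q ^ 2 <= m - p by apply: dvdn_leq => //; lia.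
have qm : q \in iota 0 m.
  by rewrite mem_iota /=; have := prime_gt1 pq; have := odd_gt0 op; nia.
by have := pgood q qm; rewrite pq dq.
Qed.

(* An integer upper bound for log2 (4 q^2 q^(1/(q-1))); the cases 3 and 5 are
   sharpened, as otherwise the sum over q would exceed 1. *)
Definition class_exponent q := if q == 3 then 6 else if q == 5 then 8 else 2 * trunc_log 2 q + 5.

(** Except for [q = 3], computed directly, one spends [e] bits on [4 * q ^ 2] and one more on the
    factor [q], using [q <= 2 ^ q.-1]. *)
Lemma class_exponentP q : prime q -> odd q ->
  (2 * q ^ 2 <= 2 ^ class_exponent q) /\
  ((4 * q ^ 2) ^ q.-1 * q <= 2 ^ (class_exponent q * q.-1)).
Proof.
move=> pq oq; have q1 := prime_gt1 pq.
have [->|q3] := eqVneq q 3; first by [].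
suff [e Ee qe] : exists2 e, class_exponent q = e.+1 & 4 * q ^ 2 <= 2 ^ e.
  rewrite Ee; split; first by rewrite (expnS 2 e) leq_mul2l (leq_trans _ qe) // leq_pmull.
  rewrite (mulSn e) addnC expnD leq_mul //; last first.
    by rewrite -{1}(prednK (prime_gt0 pq)) ltn_expl.
  by rewrite expnM leq_exp2r //; lia.
rewrite /class_exponent (negbTE q3); have [->|q5] := eqVneq q 5; first by exists 7.
exists (2 * trunc_log 2 q + 4); first by rewrite addnS.
have := trunc_log_ltn q (isT : 1 < 2); move: (trunc_log _ _) => j qj.
have : q ^ 2 <= (2 ^ j.+1) ^ 2 by rewrite leq_sqr ltnW.
rewrite -expnM (_ : 2 * j + 4 = 2 + j.+1 * 2) ?expnD; lia.
Qed.

Lemma prod_odd_square_class_le q m s : prime q -> odd q -> uniq s ->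
  {in s, forall p, [&& prime p, odd p & p <= m]} ->
  \prod_(p <- s | q ^ 2 %| m - p) p
    <= 2 ^ (class_exponent q * ((m + (4 * q ^ 2 - 2)) %/ (2 * q ^ 2 - 2))).
Proof.
move=> pq oq us sP.
have q2 : 2 < q by have := prime_gt1 pq; case: q oq {pq} => [|[|[|]]].
have [a /andP[a0 ak] aP] := odd_square_class q m oq.
have [ke He] := class_exponentP q pq oq.
have [u Hu ule] := prod_progression_primes_le q _ a (m %/ (2 * q ^ 2)).+1 pq q2 a0 ak ke He.
apply: leq_trans (_ : 2 ^ (class_exponent q * u) <= _); last first.
  have q9 : 9 <= q ^ 2 by rewrite (@leq_sqr 3).
  have k2 : 0 < 2 * q ^ 2 - 2 by lia.
  rewrite leq_pexp2l // leq_mul2l (leq_divRL _ _ k2) (mulnC u).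
  apply/orP; right; apply: leq_trans ule _.
  (* With [k = 2 q^2], one has [k N <= m + k]; adding [k - 2] gives the numerator
     [m + (4 q^2 - 2)]. *)
  by have := leq_divM m (2 * q ^ 2); rewrite mulnS (mulnC (_ %/ _)); lia.
apply: leq_trans Hu; set k := 2 * q ^ 2; set N := (m %/ k).+1.
pose t := [seq p <- [seq a + j * k | j <- iota 0 N] | prime p].
apply: (@leq_trans (\prod_(p <- t) p)).
  rewrite -big_filter; apply: (leq_prod_seq_subset _ _ id); first by rewrite filter_uniq.
    move=> p; rewrite mem_filter => /andP[dp ps]; have /and3P[pp op pm] := sP p ps.
    by rewrite mem_filter pp aP.
  by move=> p; rewrite mem_filter => /andP[/prime_gt0].
by rewrite big_filter big_map -/(index_iota 0 N) big_mkord.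
Qed.

Lemma exp_primes_leq n S : 0 < n -> n.*2 < S.+1 ^ 2 ->
  2 ^ n.*2 <= 2 ^ ((trunc_log 2 n.*2).+1 * S.+1) * \prod_(p < n.*2.+1 | prime p) p.
Proof.
move=> n0 nS; rewrite -[in 2 ^ n.*2]mul2n expnM; apply: leq_trans (expn4_central_bin n) _.
rewrite mulnS expnD -mulnA leq_mul ?trunc_log_ltn //.
apply: leq_trans (central_bin_leq n S n0 nS) _.
rewrite leq_mul2r expnM; apply/orP; right.
have [->//|S0] := posnP S.
by rewrite leq_exp2r // ltnW ?trunc_log_ltn.
Qed.

(** Base-2 logarithms of the two bounds on the product of the primes up to [2 n]. The summand 1
    accounts for the prime 2, and [i.*2.+1] runs over the odd numbers up to [S]. *)
Lemma sieve_inequality n S : 1 < n -> n.*2 < S.+1 ^ 2 ->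
  (forall p, prime p -> odd p -> p < n.*2 ->
     exists q, [/\ prime q, odd q, q ^ 2 < n.*2 & q ^ 2 %| n.*2 - p]) ->
  n.*2 <= (trunc_log 2 n.*2).+1 * S.+1 + 1 +
    \sum_(i < S.+1./2 | prime i.*2.+1)
       class_exponent i.*2.+1 *
       ((n.*2 + (4 * i.*2.+1 ^ 2 - 2)) %/ (2 * i.*2.+1 ^ 2 - 2)).
Proof.
move=> n1 nS cov; have n0 : 0 < n by lia.
pose E q := class_exponent q * ((n.*2 + (4 * q ^ 2 - 2)) %/ (2 * q ^ 2 - 2)).
pose s := [seq p <- iota 0 n.*2 | prime p && odd p].
pose r := [seq q <- [seq i.*2.+1 | i <- iota 0 S.+1./2] | prime q].
have us : uniq s by rewrite filter_uniq // iota_uniq.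
have sP : {in s, forall p, [&& prime p, odd p & p < n.*2]}.
  by move=> p; rewrite mem_filter mem_iota => /andP[/andP[-> ->]].
rewrite -(leq_exp2l _ _ (isT : 1 < 2)); apply: leq_trans (exp_primes_leq n S n0 nS) _.
rewrite -addnA expnD leq_mul2l expnD; apply/orP; right.
have -> : \sum_(i < S.+1./2 | prime i.*2.+1) E i.*2.+1 = \sum_(q <- r) E q.
  rewrite big_filter big_map -(big_mkord (fun i => prime i.*2.+1) (fun i => E i.*2.+1)).
  by rewrite /index_iota subn0.
apply: (@leq_trans (\prod_(p <- 2 :: s) p)).
  rewrite -(big_mkord prime id) -big_filter; apply: (leq_prod_seq_subset _ _ id).
  - by rewrite filter_uniq // iota_uniq.
  - move=> p; rewrite mem_filter mem_index_iota inE mem_filter mem_iota => /andP[pp /andP[_ plt]].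
    rewrite pp /=; have [->|op] := even_prime pp; rewrite ?eqxx // op /=.
    apply/orP; right; move: plt; rewrite ltnS leq_eqVlt => /orP[/eqP pE|//].
    by move: op; rewrite pE odd_double.
  - by move=> p; rewrite inE => /orP[/eqP->//|/sP/and3P[/prime_gt0]].
rewrite big_cons leq_mul // expn_sum.
apply: leq_trans (leq_prod_cover s r (fun q p => q ^ 2 %| n.*2 - p) id _ _) _.
- move=> p /sP/and3P[pp op plt]; have [q [pq oq qlt dq]] := cov p pp op plt.
  exists q => //; rewrite mem_filter pq; apply/mapP; exists q./2.
    have : q < S.+1 by rewrite -ltn_sqr; apply: leq_trans qlt _; exact: ltnW.
    by rewrite mem_iota; have := odd_double_half q; rewrite oq; lia.
  by have := odd_double_half q; rewrite oq.
- by move=> p /sP/and3P[/prime_gt0].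
rewrite big_seq [leqRHS]big_seq; apply: leq_prod => q.
rewrite mem_filter => /andP[pq /mapP[i _ qE]].
apply: prod_odd_square_class_le => //; first by rewrite qE /= odd_double.
by move=> p /sP/and3P[-> -> /ltnW].
Qed.

(** * Large values *)

Lemma trunc_log2_odd n : 0 < n -> trunc_log 2 n.*2.+1 = (trunc_log 2 n).+1.
Proof. by move=> n0; rewrite trunc_log2S /= ?uphalf_double //; lia. Qed.

Section RationalSum.
Local Open Scope ring_scope.

(* With t = 2 n and j = floor(log2 t), the last two summands are the potential
   G t = (2 j + 5) / (4 t) + 1 / 2^(j+1), chosen so that G (q - 1) - G (q + 1) is
   the term of an odd q; the jump of j at powers of 2 is absorbed by 1 / 2^(j+1). *)
Lemma sum_class_exponent_le n : (8 <= n)%N ->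
  \sum_(i < n | prime i.*2.+1) (class_exponent i.*2.+1)%:R / (8 * (i * i.+1))%:R
    + (2 * trunc_log 2 n + 7)%:R / (8 * n)%:R + 1 / (2 ^ (trunc_log 2 n).+2)%:R
  <= 19 / 20 :> rat.
Proof.
elim: n => [h|n IH]; first by exfalso; move: h.
(* For [n = 8] the primes are 3, 5, 7, 11, 13, and the total is about 0.9484, just below
   [19 / 20]. *)
rewrite leq_eqVlt => /orP[/eqP <-|n8].
  rewrite -(big_mkord (fun i => prime i.*2.+1)
    (fun i => (class_exponent i.*2.+1)%:R / (8 * (i * i.+1))%:R)) -big_filter.
  have -> : [seq i <- index_iota 0 8 | prime i.*2.+1] = [:: 1; 2; 3; 5; 6]%N by [].
  rewrite !big_cons big_nil.
  have -> : class_exponent 1.*2.+1 = 6 by [].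
  have -> : class_exponent 2.*2.+1 = 8 by [].
  have -> : class_exponent 3.*2.+1 = 9 by [].
  have -> : class_exponent 5.*2.+1 = 11 by [].
  have -> : class_exponent 6.*2.+1 = 11 by [].
  have -> : trunc_log 2 8 = 3 by [].
  rewrite /=; lra.
have n0 : (0 < n)%N by lia.
apply: le_trans (IH n8); rewrite big_mkcond big_ord_recr -big_mkcond /=.
rewrite -addrA -[leRHS]addrA -addrA lerD2l.
pose j := trunc_log 2 n.
have -> : trunc_log 2 n = j by [].
set c := (if prime _ then _ else _ : rat).
have cle : c <= (2 * j + 7)%:R / (8 * (n * n.+1))%:R.
  rewrite /c; case: ifP => _; last by rewrite divr_ge0.
  rewrite ler_wpM2r ?invr_ge0 // ler_nat /class_exponent trunc_log2_odd // -/j.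
  by case: eqP => [|_]; [lia|case: eqP => [|_]; lia].
have nn0 : (n%:R : rat) != 0 by rewrite pnatr_eq0; lia.
have nS0 : (n%:R + 1 : rat) != 0 by rewrite natr1 pnatr_eq0.
have key : (2 * j + 7)%:R / (8 * (n * n.+1))%:R + (2 * j + 7)%:R / (8 * n.+1)%:R
    = (2 * j + 7)%:R / (8 * n)%:R :> rat.
  by rewrite !natrM -(natr1 n) natrD; field; rewrite nn0 nS0.
have jn := trunc_logP (isT : 1 < 2)%N n0; have nj := trunc_log_ltn n (isT : 1 < 2)%N.
rewrite -/j in jn nj.
have [lt|ge] := ltnP n.+1 (2 ^ j.+1).
  have -> : trunc_log 2 n.+1 = j by apply: trunc_log_eq => //; lia.
  by rewrite -key addrA !lerD2r.
(* At a power of 2 the first part of the potential gains [2 / (8 * n.+1)], exactly what the last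
   part loses. *)
have E : n.+1 = (2 ^ j.+1)%N by apply/eqP; rewrite eqn_leq nj ge.
have -> : trunc_log 2 n.+1 = j.+1 by rewrite E trunc_expnK.
have p0 : (2 ^ j.+1)%:R != 0 :> rat by rewrite pnatr_eq0 expn_eq0.
have e1 : 1 / (2 ^ j.+2)%:R = 4 / (8 * n.+1)%:R :> rat.
  by rewrite E (expnS 2 j.+1) !natrM; field.
have e2 : 1 / (2 ^ j.+3)%:R = 2 / (8 * n.+1)%:R :> rat.
  by rewrite E (expnS 2 j.+2) (expnS 2 j.+1) !natrM; field.
have e3 : (2 * j.+1 + 7)%:R = (2 * j + 7)%:R + 2 :> rat by rewrite !natrD !natrM -(natr1 j); ring.
rewrite e1 e2 e3 mulrDl -key; move: cle.
move: (8 * n.+1)%:R (2 * j + 7)%:R (8 * (n * n.+1))%:R c => y x z c; lra.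
Qed.
End RationalSum.

(** At [t = 22] this reads [1840 <= 2 ^ 11]; it fails at [t = 21], whence the threshold [2 ^ 22]. *)
Lemma sqr_mul80_leq t : 22 <= t -> (80 * t.+1) ^ 2 <= 2 ^ t.
Proof.
elim: t => // t IH; rewrite leq_eqVlt => /orP[/eqP <-|t22].
  by rewrite -[22]/(11 * 2) expnM leq_exp2r.
rewrite (expnS 2 t); have := IH t22; rewrite !expnMn; nia.
Qed.

Lemma class_exponent_leq q m : 0 < q -> q ^ 2 <= m -> 22 <= trunc_log 2 m ->
  class_exponent q <= trunc_log 2 m + 5.
Proof.
move=> q0 qm t22; rewrite /class_exponent; case: eqP => _; [|case: eqP => _]; try lia.
rewrite leq_add2r; apply: trunc_log_max => //; apply: leq_trans qm.
by rewrite mulnC expnM leq_sqr trunc_logP.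
Qed.

(** With [D = 2 q^2 - 2 = 8 i (i + 1)] each quotient is at most [m / D + 3]. The terms [m / D] sum
    to at most [19 / 20 m]; the 3's give the error term. *)
Lemma class_sum_leq m S : 22 <= trunc_log 2 m -> 16 <= S -> S ^ 2 <= m ->
  20 * (\sum_(i < S.+1./2 | prime i.*2.+1) class_exponent i.*2.+1 *
       ((m + (4 * i.*2.+1 ^ 2 - 2)) %/ (2 * i.*2.+1 ^ 2 - 2)))
  <= 19 * m + 60 * (S.+1./2 * (trunc_log 2 m + 5)).
Proof.
move=> t22 S16 Sm; set N := S.+1./2.
have N8 : 7 < N by rewrite /N; lia.
have Hsum := sum_class_exponent_le N N8.
set W := (\sum_(i < N | _) _)%R in Hsum.
have {Hsum} HW : (W <= 19 / 20)%R.
  apply: le_trans Hsum; rewrite -addrA lerDl addr_ge0 // ?divr_ge0 //.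
rewrite -(ler_nat rat) natrM natr_sum natrD !natrM.
have -> : (19%:R * m%:R = 20 * (19 / 20 * m%:R) :> rat)%R by field.
have -> : (60%:R = 20 * 3%:R :> rat)%R by rewrite -natrM.
rewrite -[X in (_ <= _ + X)%R]mulrA -mulrDr ler_pM2l; last by rewrite ltr0n.
apply: (@le_trans _ _ (W * m%:R + 3%:R * (N%:R * (trunc_log 2 m + 5)%:R))%R); last first.
  by rewrite lerD2r ler_wpM2r.
rewrite mulr_suml.
have -> : (3%:R * (N%:R * (trunc_log 2 m + 5)%:R) =
    \sum_(i < N) 3%:R * (trunc_log 2 m + 5)%:R :> rat)%R.
  by rewrite sumr_const card_ord -[RHS]mulr_natl; ring.
rewrite big_mkcond [X in (X + _)%R]big_mkcond -big_split /=.
apply: ler_sum => i _; case: ifP => [pq|_]; last by rewrite add0r mulr_ge0.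
have i0 : (0 < i)%N by case: (i : nat) pq.
have iN : (i < N)%N := ltn_ord i.
have eq : class_exponent i.*2.+1 <= trunc_log 2 m + 5.
  apply: class_exponent_leq => //; apply: leq_trans Sm; rewrite leq_sqr.
  by move: iN; rewrite /N; lia.
set D := 2 * _ - 2.
have DE : D = 8 * (i * i.+1) by rewrite /D -mul2n; lia.
have D2 : 2 < D by rewrite DE; nia.
have -> : 4 * i.*2.+1 ^ 2 - 2 = 2 * D + 2 by rewrite /D -mul2n; lia.
have dle : (m + (2 * D + 2)) %/ D <= m %/ D + 3.
  rewrite -ltnS ltn_divLR; last by lia.
  have D0 : 0 < D by lia.
  by have := ltn_ceil m D0; nia.
rewrite -DE natrM; move: (class_exponent _) eq => e ee.
have D0 : (0 < D%:R :> rat)%R by rewrite ltr0n; lia.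
apply: (@le_trans _ _ (e%:R * (m%:R / D%:R + 3%:R))%R); last first.
  rewrite mulrDr mulrA mulrAC lerD2l mulrC ler_wpM2l // ler_nat //.
rewrite ler_wpM2l //; apply: (@le_trans _ _ (m %/ D + 3)%:R%R); first by rewrite ler_nat.
by rewrite natrD lerD2r ler_pdivlMr // -natrM ler_nat leq_divM.
Qed.

(** Put [t = trunc_log 2 m]. After multiplication by 20 the errors are about [50 t S], whereas
    [80 (t + 1) S <= S ^ 2 <= m]. *)
Lemma sieve_inequality_absurd m S : 22 <= trunc_log 2 m -> S ^ 2 <= m -> m < S.+1 ^ 2 ->
  (trunc_log 2 m).+1 * S.+1 + 1 +
    \sum_(i < S.+1./2 | prime i.*2.+1) class_exponent i.*2.+1 *
       ((m + (4 * i.*2.+1 ^ 2 - 2)) %/ (2 * i.*2.+1 ^ 2 - 2)) < m.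
Proof.
move=> t22 Sm mS.
have m0 : 0 < m by case: m t22 {Sm mS}.
have SL : 80 * (trunc_log 2 m).+1 <= S.
  rewrite -ltnS -ltn_sqr; apply: leq_ltn_trans mS.
  by apply: leq_trans (sqr_mul80_leq _ t22) (trunc_logP _ m0).
have S16 : 16 <= S by lia.
have := class_sum_leq m S t22 S16 Sm.
have : S.+1./2.*2 <= S.+1 by rewrite -[leqRHS]odd_double_half leq_addl.
set X := \sum_(_ < _ | _) _; move: X (trunc_log 2 m) t22 SL => X t t22 SL.
move: S.+1./2 => N HX NS; nia.
Qed.

Lemma prime_squarefree_large m : ~~ odd m -> 22 <= trunc_log 2 m ->
  exists p, [/\ prime p, p < m & squarefree (m - p)].
Proof.
move=> om t22.
pose s := [seq p <- iota 0 m | prime p && odd p].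
have sP p : p \in s -> [/\ prime p, odd p & p < m].
  by rewrite mem_filter mem_iota => /andP[/andP[-> ->]].
have [p /sP[_ -> ->]//|[p /sP[pp _ pm] sq]|cov] := squarefree_or_cover m s om.
  by exists p.
have [S Sm mS] : exists2 S, S ^ 2 <= m & m < S.+1 ^ 2.
  have ex : exists S, S ^ 2 <= m by exists 0.
  have ub S : S ^ 2 <= m -> S <= m by nia.
  case: (ex_maxnP ex ub) => S Sm Smax; exists S => //.
  by rewrite ltnNge; apply/negP => /Smax; rewrite ltnn.
have mE : m = m./2.*2 by rewrite -[LHS]odd_double_half (negbTE om).
have m1 : 1 < m./2 by case: m t22 {om s sP cov Sm mS mE} => [|[|[|[|m]]]].
exfalso; have := sieve_inequality_absurd m S t22 Sm mS.
apply/negP; rewrite -leqNgt [X in X <= _]mE [in leqRHS]mE.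
apply: sieve_inequality => //; rewrite -mE // => p pp op pm.
by apply: cov; rewrite mem_filter pp op mem_iota.
Qed.

(** * Small values *)

Definition odd_primes_below n := [seq p <- iota 0 n | odd p && prime p].

(* For q <> 3 the odd integers of the class are counted, prime or not; only the
   class mod 9 is too large for that. *)
Definition class_count_bound y (P : seq nat) q :=
  if q == 3 then
    let R := [seq p %% 9 | p <- P] in foldr maxn 0 [seq count_mem r R | r <- iota 0 9]
  else (y %/ 2 %/ q %/ q).+1.

Lemma count_odd_square_class y m q : odd q -> y <= m ->
  count (fun p => q ^ 2 %| m - p) (odd_primes_below y)
    <= class_count_bound y (odd_primes_below y) q.
Proof.
move=> oq ym; rewrite /class_count_bound.
have sP p : p \in odd_primes_below y -> odd p && (p < y).
  by rewrite mem_filter mem_iota => /andP[/andP[-> _] ->].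
case: eqP => [->|_].
  (* The maximum over all residues modulo 9 makes the bound independent of [m]. *)
  rewrite foldrE big_map.
  apply: leq_trans (leq_bigmax_seq (m %% 9) _ isT); last by rewrite mem_iota ltn_mod.
  rewrite count_map leq_eqVlt; apply/orP; left; apply/eqP/eq_in_count => p /sP/andP[_ py].
  by rewrite /= eq_sym -eqn_mod_dvd //; apply: ltnW; apply: leq_trans ym.
have [a _ aP] := odd_square_class q m oq.
rewrite -size_filter (_ : y %/ 2 %/ q %/ q = y %/ (2 * q ^ 2)); last first.
  by rewrite -mulnn !divnMA.
set N := (y %/ (2 * q ^ 2)).+1.
apply: (@leq_trans (size [seq a + j * (2 * q ^ 2) | j <- iota 0 N])).
  apply: uniq_leq_size; first by rewrite !filter_uniq ?iota_uniq.
  move=> p; rewrite mem_filter => /andP[dp /sP/andP[op py]].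
  by apply: (aP y) => //; [exact: ltnW | apply: ltnW; exact: leq_trans ym].
by rewrite size_map size_iota.
Qed.

Definition pigeonhole_check y T :=
  let P := odd_primes_below y in
  sumn [seq class_count_bound y P q | q <- odd_primes_below T] < size P.

(** Otherwise every odd prime below [y] lies in the class of some odd prime [q < T], and the class
    bounds, free of [m], would add up to at least the number of these primes. *)
Lemma prime_squarefree_pigeonhole y T m : pigeonhole_check y T ->
  ~~ odd m -> y <= m -> m <= T ^ 2 ->
  exists p, [/\ prime p, p < m & squarefree (m - p)].
Proof.
move=> chk om ym mT.
have sP p : p \in odd_primes_below y -> [/\ prime p, odd p & p < m].
  by rewrite mem_filter mem_iota => /andP[/andP[-> ->] /= py]; split=> //; apply: leq_trans ym.
have [p /sP[_ -> ->]//|[p /sP[pp _ pm] sq]|cov] := squarefree_or_cover m (odd_primes_below y) om.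
  by exists p.
exfalso; move: chk; apply/negP; rewrite /pigeonhole_check /= -leqNgt.
rewrite -(leq_exp2l _ _ (isT : 1 < 2)).
(* Counting is done with a product of 2's, so that leq_prod_cover applies. *)
have -> : 2 ^ size (odd_primes_below y) = \prod_(p <- odd_primes_below y) 2.
  by rewrite big_const_seq count_predT iter_muln_1.
apply: leq_trans (leq_prod_cover _ (odd_primes_below T) (fun q p => q ^ 2 %| m - p) _ _ _) _ => //.
  move=> p /cov[q [pq oq qm dq]]; exists q => //.
  rewrite mem_filter oq pq mem_iota /= add0n -ltn_sqr; exact: leq_trans mT.
rewrite sumnE big_map expn_sum [leqLHS]big_seq [leqRHS]big_seq; apply: leq_prod => q.
rewrite mem_filter => /andP[/andP[oq _] _].
by rewrite big_const_seq iter_muln_1 leq_exp2l // count_odd_square_class.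
Qed.

Lemma prime_squarefree_tiny m : 4 <= m -> m < 30 -> ~~ odd m ->
  exists p, [/\ prime p, p < m & squarefree (m - p)].
Proof.
move=> m4 m30 om.
(* Only [q] from 2 to 6 need testing, as [7 ^ 2] exceeds 30. *)
pose good n p := [&& prime p, p < n & all (fun q => ~~ (q ^ 2 %| n - p)) (iota 2 5)].
have /allP chk : all (fun n => (4 <= n) && ~~ odd n ==> has (good n) (iota 0 30)) (iota 0 30).
  by vm_compute.
have : m \in iota 0 30 by rewrite mem_iota.
move=> /chk; rewrite m4 om => /hasP[p _ /and3P[pp pm /allP sq]].
exists p; split=> //; split=> [|q pq]; first by lia.
have [q7|q7] := ltnP q 7.
  by apply: sq; rewrite mem_iota prime_gt1.
apply/negP => /dvdn_leq; have : 7 ^ 2 <= q ^ 2 by rewrite leq_sqr.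
by rewrite subn_gt0 pm; lia.
Qed.

(** The three checks serve the overlapping ranges from 30 to [17 ^ 2 = 289], from 289 to
    [71 ^ 2 = 5041], and from 5000 to [2 ^ 22]. *)
Lemma pigeonhole_check_30 : pigeonhole_check 30 17. Proof. by vm_compute. Qed.

Lemma pigeonhole_check_289 : pigeonhole_check 289 71. Proof. by vm_compute. Qed.

Lemma pigeonhole_check_5000 : pigeonhole_check 5000 (2 ^ 11). Proof. by vm_compute. Qed.

Lemma prime_squarefree_even m : 4 <= m -> ~~ odd m ->
  exists p, [/\ prime p, p < m & squarefree (m - p)].
Proof.
move=> m4 om.
have [/prime_squarefree_tiny|m30] := ltnP m 30; first exact.
have [|m289] := leqP m (17 ^ 2);
  first exact: (prime_squarefree_pigeonhole 30 17 m pigeonhole_check_30 om m30).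
have [|m5041] := leqP m (71 ^ 2).
  exact: (prime_squarefree_pigeonhole 289 71 m pigeonhole_check_289 om (ltnW m289)).
have [|t22] := leqP 22 (trunc_log 2 m); first exact: prime_squarefree_large.
apply: (prime_squarefree_pigeonhole 5000 (2 ^ 11) m pigeonhole_check_5000 om).
  by apply: leq_trans (ltnW m5041); vm_compute.
rewrite -expnM; apply: leq_trans (ltnW (trunc_log_ltn m (isT : 1 < 2))) _.
by rewrite leq_exp2l.
Qed.

Theorem corollary2 (n : nat) (hn : 4 < n) :
  exists p1 p2 eta : nat,
    [/\ prime p1, prime p2, squarefree eta & n = p1 + p2 + eta].
Proof.
(* For [n = 5] the even number [n - 3] is below 4, so [5 = 2 + 2 + 1] is given directly. *)
have [->|n5] := eqVneq n 5.
  exists 2, 2, 1; split=> //; split=> // p pp.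
  by rewrite dvdn1 -(expn1 1) -[_ == _]/(p ^ 2 == 1 ^ 2) eqn_sqr neq_ltn prime_gt1 ?orbT.
pose p1 := if odd n then 3 else 2.
have [p [pp pm sq]] : exists p, [/\ prime p, p < n - p1 & squarefree (n - p1 - p)].
  by apply: prime_squarefree_even; rewrite /p1 ?oddB; case: ifP => //; lia.
have pp1 : prime p1 by rewrite /p1; case: ifP.
by exists p1, p, (n - p1 - p); split=> //; lia.
Qed.
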